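(* Let $n,T$ be positive integers, let $\Theta\subseteq\mathbb{R}^n$ be a closed convex set, and let $c^*\in\Theta$. For $t=1,\dots,T$ let $X_t\subseteq\mathbb{R}^n$ be non-empty and compact and let $x_t\in X_t$ be an arbitrary (possibly suboptimal) action of the agent. Assume: the $\ell_2$-diameter of $\Theta$ is at most $D>0$; the $\ell_2$-diameter of each $X_t$ is at most $K>0$; and there is $B>0$ with $\max\{\langle c-c',x-x'\rangle : c,c'\in\Theta,\ x,x'\in X_t\}\le B$ for all $t$. Define the suboptimality losses $\ell_t(c)\coloneqq\max_{x\in X_t}\langle c,x\rangle-\langle c,x_t\rangle$ for $c\in\Theta$, and $\Delta_T\coloneqq\sum_{t=1}^T\ell_t(c^* )$. Let $\hat c_1,\dots,\hat c_T\in\Theta$ be the outputs of MetaGrad (described in the context) applied to $\ell_1,\dots,\ell_T$, and let $\hat x_t\in\arg\max_{x\in X_t}\langle\hat c_t,x\rangle$. Then $$R^{c^*}_T\coloneqq\sum_{t=1}^T\langle c^*,x_t-\hat x_t\rangle\le\tilde R^{c^*}_T\coloneqq\sum_{t=1}^T\langle\hat c_t-c^*,\hat x_t-x_t\rangle=O\!\left(Bn\ln\!\left(\frac{DKT}{Bn}\right)+\sqrt{\Delta_T\,Bn\ln\!\left(\frac{DKT}{Bn}\right)}\right),$$ where the $O$ hides an absolute constant.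
   Context: MetaGrad on $\mathcal{W}=\Theta$ (diameter $W=D$), with subgradient bound $G=K$ and $H=B$: let $\mathcal{G}=\{\eta_i=\frac{2^{-i}}{5H}: i=0,1,\dots,\lceil\frac12\log_2T\rceil\}$, and initial weights $p^{\eta_i}_1=\frac{C}{(i+1)(i+2)}$ with $C=1+\frac{1}{1+\lceil\frac12\log_2T\rceil}$. For each $\eta\in\mathcal{G}$ an ''$\eta$-expert'' runs Online Newton Step (ONS) on $\Theta$ producing $w^\eta_t$, with losses $f^\eta_t(w)=-\eta\langle w_t-w,g_t\rangle+\eta^2\langle w_t-w,g_t\rangle^2$. In round $t$: MetaGrad plays $w_t=\frac{\sum_{\eta\in\mathcal{G}}\eta p^\eta_t w^\eta_t}{\sum_{\eta\in\mathcal{G}}\eta p^\eta_t}$ (here $\hat c_t=w_t$), observes the subgradient $g_t=\hat x_t-x_t\in\partial\ell_t(\hat c_t)$, and sets $p^\eta_{t+1}=p^\eta_t e^{-f^\eta_t(w^\eta_t)}/Z_t$ with $Z_t=\sum_{\eta\in\mathcal{G}}p^\eta_te^{-f^\eta_t(w^\eta_t)}$. ONS with parameter $\gamma$ on losses $q_t$: $\varepsilon=\frac{n}{W^2\gamma^2}$, $A_0=\varepsilon I_n$, any $w_1\in\mathcal{W}$; $A_t=A_{t-1}+\nabla q_t(w_t)\nabla q_t(w_t)^\top$, $w_{t+1}=\arg\min_{w\in\mathcal{W}}\|w_t-\frac1\gamma A_t^{-1}\nabla q_t(w_t)-w\|_{A_t}^2$ with $\|y\|_A=\sqrt{y^\top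 Ay}$. For the $\eta$-expert, $q_t=f^\eta_t$ and $\gamma=\frac{1}{(1+2\eta H)^2}$.
   Formalization: The formal theorem additionally assumes DKT ≥ e·Bn, i.e. ln(DKT/(Bn)) ≥ 1; without it the bound fails, e.g. n=T=1, Θ=X_1=[0,1], D=K=B=1, c*=0, x_1=0, first iterate 1: the regret is 1 but the right side is 0. *)

(* Defs.v *)
From HB Require Import structures.
From mathcomp Require Import all_boot all_order all_algebra.
From mathcomp Require Import all_classical all_reals all_analysis.
Set Implicit Arguments. Unset Strict Implicit. Unset Printing Implicit Defensive.
Import Order.TTheory GRing.Theory Num.Theory.
Import numFieldNormedType.Exports.
Local Open Scope classical_set_scope.
Local Open Scope ring_scope.

Section Defs.
Variables (R : realType) (n : nat).

Definition dot (u v : 'cV[R]_n) : R := (u^T *m v) 0 0.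
Definition l2norm (u : 'cV[R]_n) : R := Num.sqrt (dot u u).
Definition Anorm2 (A : 'M[R]_n) (y : 'cV[R]_n) : R := (y^T *m A *m y) 0 0.

Definition convex_set_R (S : set 'cV[R]_n) : Prop :=
  forall a b, S a -> S b -> forall l : R, 0 <= l <= 1 ->
    S (l *: a + (1 - l) *: b).

Definition diam_le (S : set 'cV[R]_n) (d : R) : Prop :=
  forall a b, S a -> S b -> l2norm (a - b) <= d.

Definition is_argmax_lin (S : set 'cV[R]_n) (c y : 'cV[R]_n) : Prop :=
  S y /\ forall x, S x -> dot c x <= dot c y.

Definition subopt_loss (X : set 'cV[R]_n) (xt c : 'cV[R]_n) : R :=
  sup [set dot c x | x in X] - dot c xt.

(* ---- MetaGrad parameters (W = D, G = K, H = B) ---- *)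
(* number of grid points minus one: ceil( (1/2) log2 T ) *)
Definition mg_N (T : nat) : nat := `| Num.ceil (ln (T%:R : R) / (2 * ln 2)) |%N.
Definition mg_eta (H : R) (i : nat) : R := (2 ^- i) / (5 * H).
Definition mg_C (T : nat) : R := 1 + 1 / (1 + (mg_N T)%:R).
Definition mg_prior (T : nat) (i : nat) : R :=
  mg_C T / ((i.+1)%:R * (i.+2)%:R).
Definition mg_gamma (H : R) (i : nat) : R := 1 / (1 + 2 * mg_eta H i * H) ^+ 2.
Definition ons_eps (W gam : R) : R := n%:R / (W ^+ 2 * gam ^+ 2).

Definition surr_loss (eta : R) (wt gt w : 'cV[R]_n) : R :=
  - eta * dot (wt - w) gt + eta ^+ 2 * (dot (wt - w) gt) ^+ 2.
Definition surr_grad (eta : R) (wt gt w : 'cV[R]_n) : 'cV[R]_n :=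
  eta *: gt - (2 * eta ^+ 2 * dot (wt - w) gt) *: gt.

End Defs.

(* Main.v *)
(* Write [r t = dot (chat t - cstar) (xhat t - x t)], [Rt] for its sum and [V] for the sum of its squares. Exponential weights keep the total weight at most 1, since [expR (x - x ^+ 2) <= 1 + x] and the tilted average [chat t] makes the linear terms cancel; together with the logarithmic regret of each Online Newton Step expert on its surrogate loss this gives, for every rate [eta] of the grid, [eta * Rt <= eta ^+ 2 * V + O(n * L) + 2 * i + 1], where [2 * i + 1] is the cost of the prior of the [i]-th rate. The best rate yields [Rt = O(B * n * L + sqrt (V * n * L))]. Finally [V <= B * (Rt + 2 * Delta)], because [r t] is at least minus the suboptimality loss of [cstar], and one solves for [Rt]. When [T < n] the bound [Rt <= B * T] suffices. *)
Require Import Defs.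
From HB Require Import structures.
From mathcomp Require Import all_boot all_order all_algebra.
From mathcomp Require Import all_classical all_reals all_analysis.
From mathcomp Require Import ring lra.
Import Order.TTheory GRing.Theory Num.Theory.
Import numFieldNormedType.Exports.
Local Open Scope classical_set_scope.
Local Open Scope ring_scope.

Section DotProduct.
Context {R : realType} {n : nat}.
Implicit Types (u v y : 'cV[R]_n) (A : 'M[R]_n).

Lemma dotE u v : dot u v = \sum_i u i 0 * v i 0.
Proof. by rewrite /dot mxE; apply: eq_bigr => i _; rewrite mxE. Qed.

Lemma dotC u v : dot u v = dot v u.
Proof. by rewrite !dotE; apply: eq_bigr => i _; rewrite mulrC. Qed.

Lemma dotDl u v y : dot (u + v) y = dot u y + dot v y.
Proof. by rewrite /dot linearD mulmxDl mxE. Qed.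

Lemma dotZl a u v : dot (a *: u) v = a * dot u v.
Proof. by rewrite /dot linearZ -scalemxAl mxE. Qed.

Lemma dotNl u v : dot (- u) v = - dot u v.
Proof. by rewrite -scaleN1r dotZl mulN1r. Qed.

Lemma dotBl u v y : dot (u - v) y = dot u y - dot v y.
Proof. by rewrite dotDl dotNl. Qed.

Lemma dotDr u v y : dot y (u + v) = dot y u + dot y v.
Proof. by rewrite dotC dotDl !(dotC y). Qed.

Lemma dotZr a u v : dot u (a *: v) = a * dot u v.
Proof. by rewrite dotC dotZl dotC. Qed.

Lemma dotNr u v : dot u (- v) = - dot u v.
Proof. by rewrite dotC dotNl dotC. Qed.

Lemma dotBr u v y : dot y (u - v) = dot y u - dot y v.
Proof. by rewrite dotDr dotNr. Qed.

Lemma dot0l u : dot 0 u = 0.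
Proof. by rewrite /dot linear0 mul0mx mxE. Qed.

Lemma dot0r u : dot u 0 = 0.
Proof. by rewrite dotC dot0l. Qed.

Lemma dot_suml m (F : nat -> 'cV[R]_n) v :
  dot (\sum_(i < m) F i) v = \sum_(i < m) dot (F i) v.
Proof.
elim: m => [|m IH]; last by rewrite !big_ord_recr /= dotDl IH.
by rewrite !big_ord0 dot0l.
Qed.

Lemma dot_ge0 u : 0 <= dot u u.
Proof. by rewrite dotE sumr_ge0 // => i _; rewrite -expr2 sqr_ge0. Qed.

Lemma dot_gt0 u : u != 0 -> 0 < dot u u.
Proof.
move=> u0; rewrite lt_neqAle dot_ge0 andbT eq_sym; apply: contraNneq u0.
rewrite dotE => /eqP; rewrite psumr_eq0; last by move=> i _; rewrite -expr2 sqr_ge0.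
move=> /allP u0; apply/eqP/matrixP => i j; rewrite ord1 !mxE.
by have := u0 i (mem_index_enum i); rewrite /= mulf_eq0 orbb => /eqP.
Qed.

Lemma dot_sqr_le u v : dot u v ^+ 2 <= dot u u * dot v v.
Proof.
have [->|v0] := eqVneq v 0.
  by rewrite !dot0r expr0n mulr0.
have vv := dot_gt0 v v0.
have := dot_ge0 (dot v v *: u - dot u v *: v).
rewrite dotBl !dotBr !dotZl !dotZr (dotC v u) => H.
have : 0 <= dot v v * (dot u u * dot v v - dot u v ^+ 2).
  by apply: le_trans H _; rewrite le_eqVlt; apply/orP; left; apply/eqP; ring.
by rewrite pmulr_rge0 // subr_ge0.
Qed.

Lemma dot_le_l2norm u v : dot u v <= l2norm u * l2norm v.
Proof.
rewrite /l2norm -sqrtrM ?dot_ge0 //; apply: le_trans (ler_norm _) _.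
by rewrite -sqrtr_sqr ler_sqrt ?dot_sqr_le // mulr_ge0 ?dot_ge0.
Qed.

Lemma Anorm2E A u : Anorm2 A u = dot u (A *m u).
Proof. by rewrite /Anorm2 /dot mulmxA. Qed.

Lemma dot_trmx A u v : dot u (A *m v) = dot (A^T *m u) v.
Proof. by rewrite /dot trmx_mul trmxK mulmxA. Qed.

Lemma rank1_mulmx u v : (u *m u^T) *m v = dot u v *: u.
Proof. by rewrite -mulmxA [u^T *m v]mx11_scalar mul_mx_scalar. Qed.

Lemma Anorm2_scalar a u : Anorm2 a%:M u = a * dot u u.
Proof. by rewrite Anorm2E mul_scalar_mx dotZr. Qed.

Lemma Anorm2_rank1D A u v :
  Anorm2 (A + u *m u^T) v = Anorm2 A v + dot u v ^+ 2.
Proof. by rewrite !Anorm2E mulmxDl dotDr rank1_mulmx dotZr (dotC v u) expr2. Qed.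

Lemma Anorm2B A u v : A^T = A ->
  Anorm2 A (u - v) = Anorm2 A u - 2 * dot u (A *m v) + Anorm2 A v.
Proof.
move=> sA; rewrite !Anorm2E mulmxBr dotBl !dotBr (dot_trmx _ v u) sA.
by rewrite (dotC _ u); ring.
Qed.

End DotProduct.

Definition posdef {R : realType} {n : nat} (A : 'M[R]_n) : Prop :=
  A^T = A /\ forall y : 'cV[R]_n, y != 0 -> 0 < Anorm2 A y.

Section PositiveDefinite.
Context {R : realType} {n : nat}.
Implicit Types (u v y : 'cV[R]_n) (A : 'M[R]_n).

Lemma posdef_ge0 A y : posdef A -> 0 <= Anorm2 A y.
Proof.
move=> [_ pA]; have [->|/pA/ltW//] := eqVneq y 0.
by rewrite Anorm2E dot0l.
Qed.

Lemma posdef_unitmx A : posdef A -> A \in unitmx.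
Proof.
move=> [sA pA]; rewrite -row_free_unit -kermx_eq0.
apply: contraT => /rowV0Pn[v /sub_kermxP vA v0].
have := pA v^T; rewrite -[v^T == 0]trmx_eq0 trmxK => /(_ v0).
by rewrite /Anorm2 trmxK vA mul0mx mxE ltxx.
Qed.

Lemma posdef_scalar a : 0 < a -> posdef (a%:M : 'M[R]_n).
Proof.
move=> a0; split; first by rewrite tr_scalar_mx.
by move=> y y0; rewrite Anorm2_scalar mulr_gt0 ?dot_gt0.
Qed.

Lemma posdef_rank1D A v : posdef A -> posdef (A + v *m v^T).
Proof.
move=> [sA pA]; split; first by rewrite linearD /= trmx_mul trmxK sA.
by move=> y /pA y0; rewrite Anorm2_rank1D ltr_pwDl // sqr_ge0.
Qed.

Lemma posdef_invmx_ge0 A v : posdef A -> 0 <= dot v (invmx A *m v).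
Proof.
move=> pA; have uA := posdef_unitmx A pA; have := posdef_ge0 A (invmx A *m v) pA.
by rewrite Anorm2E mulmxA mulmxV // mul1mx dotC.
Qed.

Lemma det_rank1D A v : A \in unitmx ->
  \det (A + v *m v^T) = \det A * (1 + dot v (invmx A *m v)).
Proof.
move=> uA; have -> : A + v *m v^T = A *m (1%:M + invmx A *m v *m v^T).
  by rewrite mulmxDr mulmx1 !mulmxA mulmxV // mul1mx.
rewrite det_mulmx; congr (_ * _); set w := invmx A *m v.
have E1 : block_mx 1%:M 0 w 1%:M *m block_mx 1%:M (- v^T) 0 (1%:M + w *m v^T)
        = block_mx 1%:M (- v^T) w (1%:M : 'M[R]_n).
  rewrite mulmx_block !(mul0mx, mulmx0, mul1mx, mulmx1, addr0, add0r).
  by rewrite mulmxN addrC addrK.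
have E2 : block_mx 1%:M (- v^T) 0 1%:M *m block_mx (1%:M + v^T *m w) 0 w 1%:M
        = block_mx (1%:M : 'M[R]_1) (- v^T) w (1%:M : 'M[R]_n).
  rewrite mulmx_block !(mul0mx, mulmx0, mul1mx, mulmx1, addr0, add0r).
  by rewrite mulNmx addrK.
move: (congr1 determinant E1); rewrite -E2 !det_mulmx.
rewrite !det_ublock !det_lblock !det1 !(mul1r, mulr1) => ->.
by rewrite det_mx11 mxE [1%:M _ _]mxE.
Qed.

End PositiveDefinite.

(* Hadamard's inequality, by induction through the Schur complement of [A 0 0]. *)
Lemma posdef_det_le_diag {R : realType} {n : nat} (A : 'M[R]_n) : posdef A ->
  0 < \det A <= \prod_i A i i.
Proof.
elim: n A => [|n IH]; first by move=> A _; rewrite det_mx00 big_ord0 lexx ltr01.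
rewrite -[n.+1]/(1 + n)%N => A pA; have [sA PA] := pA.
pose a := A (lshift n 0) (lshift n 0); pose b := dlsubmx A; pose C := drsubmx A.
have sC : C^T = C by rewrite /C trmx_drsub sA.
have AE : A = block_mx a%:M b^T b C.
  by rewrite -[LHS]submxK [ulsubmx A]mx11_scalar !mxE /b trmx_dlsub sA.
have AN z y : Anorm2 A (col_mx z%:M y) =
    a * z ^+ 2 + 2 * z * dot b y + Anorm2 C y.
  rewrite Anorm2E AE mul_block_col /dot tr_col_mx mul_row_col.
  rewrite !mulmxDr tr_scalar_mx !mul_scalar_mx mul_mx_scalar -scalemxAr.
  have mxD (P Q : 'M[R]_1) : (P + Q) 0 0 = P 0 0 + Q 0 0 by rewrite mxE.
  have mxZ c (P : 'M[R]_1) : (c *: P) 0 0 = c * P 0 0 by rewrite mxE.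
  rewrite Anorm2E !mxD !mxZ [z%:M 0 0]mxE eqxx mulr1n.
  by rewrite -/(dot b y) -/(dot y b) -/(dot y (C *m y)) (dotC y b); ring.
have a0 : 0 < a.
  have := PA (col_mx 1%:M 0).
  rewrite AN dot0r Anorm2E dot0l expr1n !mulr0 !addr0 mulr1; apply.
  apply/negP => /eqP /(congr1 usubmx); rewrite col_mxKu linear0 => /matrixP/(_ 0 0).
  by rewrite !mxE => /eqP; rewrite oner_eq0.
pose C' := C - a^-1 *: (b *m b^T).
pose v := Num.sqrt a^-1 *: b.
have CE : C = C' + v *m v^T.
  have -> : v *m v^T = a^-1 *: (b *m b^T); last by rewrite subrK.
  rewrite /v [X in _ *m X]linearZ /= -scalemxAr -scalemxAl scalerA -expr2 sqr_sqrtr //.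
  by rewrite invr_ge0 ltW.
have pC' : posdef C'.
  split; first by rewrite linearB /= linearZ /= trmx_mul trmxK sC.
  move=> y y0; have := PA (col_mx (- (a^-1 * dot b y))%:M y).
  have -> : Anorm2 C' y = Anorm2 C y - a^-1 * dot b y ^+ 2.
    rewrite !Anorm2E mulmxBl -scalemxAl rank1_mulmx dotBr !dotZr (dotC y b); ring.
  have a0' : a != 0 by rewrite gt_eqF.
  rewrite AN.
  have -> : a * (- (a^-1 * dot b y)) ^+ 2 + 2 * - (a^-1 * dot b y) * dot b y
     + Anorm2 C y = Anorm2 C y - a^-1 * dot b y ^+ 2 by field.
  apply; apply: contra_neq y0 => /(congr1 dsubmx).
  by rewrite col_mxKd linear0.
have detA : \det A = a * \det C'.
  have : A *m block_mx 1%:M (- (a^-1 *: b^T)) 0 1%:M = block_mx a%:M 0 b C'.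
    rewrite AE mulmx_block !(mulmx1, mulmx0, addr0) mul_scalar_mx scalerN scalerA.
    by rewrite mulfV ?gt_eqF // scale1r addNr mulmxN -scalemxAr addrC.
  move=> /(congr1 determinant); rewrite det_mulmx det_ublock !det1 !mulr1 => ->.
  by rewrite det_lblock det_scalar1.
have /andP[C'0 C'le] := IH _ pC'.
have pC : posdef C by rewrite CE; apply: posdef_rank1D.
have /andP[_ Cle] := IH _ pC.
have C'C : \det C' <= \det C.
  rewrite CE det_rank1D ?posdef_unitmx // ler_peMr ?(ltW C'0) //.
  by rewrite lerDl posdef_invmx_ge0.
rewrite detA mulr_gt0 //= big_split_ord big_ord1 ler_pM2l //.
apply: le_trans C'C _; apply: le_trans Cle _.
rewrite le_eqVlt; apply/orP; left; apply/eqP.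
by apply: eq_bigr => i _; rewrite !mxE.
Qed.

Section OnlineNewtonStep.
Context {R : realType} {n : nat}.
Implicit Types (u v y z : 'cV[R]_n) (A : 'M[R]_n) (Theta : set 'cV[R]_n).

Lemma Anorm2_proj_le Theta A u y z :
  convex_set_R Theta -> posdef A -> Theta z -> Theta u ->
  (forall v, Theta v -> Anorm2 A (y - z) <= Anorm2 A (y - v)) ->
  Anorm2 A (z - u) <= Anorm2 A (y - u).
Proof.
move=> cvx pA Tz Tu zmin; have [sA _] := pA.
pose d := y - z; pose h := u - z; pose a := dot d (A *m h); pose b := Anorm2 A h.
have b0 : 0 <= b by apply: posdef_ge0.
have AZ l : Anorm2 A (d - l *: h) = Anorm2 A d - 2 * l * a + l ^+ 2 * b.
  by rewrite Anorm2B // -/a /b !Anorm2E -!scalemxAr !dotZl !dotZr -/a; ring.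
have along l : 0 <= l <= 1 -> 2 * l * a <= l ^+ 2 * b.
  move=> l01; have := zmin _ (cvx _ _ Tu Tz _ l01).
  have -> : y - (l *: u + (1 - l) *: z) = d - l *: h.
    by apply/matrixP => i j; rewrite !mxE; ring.
  by rewrite AZ -/d; lra.
have a0 : a <= 0.
  rewrite leNgt; apply/negP => a0; have ab : 0 < a + b by lra.
  pose l := a / (a + b).
  have l0 : 0 < l by rewrite divr_gt0.
  have l1 : l <= 1 by rewrite ler_pdivrMr ?mul1r //; lra.
  have lab : l * a + l * b = a by rewrite -mulrDr divfK ?gt_eqF.
  have := along l (introT andP (conj (ltW l0) l1)).
  have -> : l ^+ 2 * b = l * (l * b) by ring.
  have -> : 2 * l * a = l * (2 * a) by ring.
  by rewrite ler_pM2l //; have := mulr_gt0 l0 a0; lra.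
have -> : y - u = d - 1 *: h.
  by rewrite scale1r /d /h opprB addrA subrK.
have -> : z - u = 0 - 1 *: h by rewrite scale1r /h sub0r opprB.
have -> : Anorm2 A (0 - 1 *: h) = b.
  by rewrite scale1r sub0r /b !Anorm2E mulmxN dotNl dotNr opprK.
by rewrite AZ; have := posdef_ge0 A d pA; lra.
Qed.

Lemma rank1D_quad_le_ln A v : posdef A ->
  dot v (invmx (A + v *m v^T) *m v)
    <= ln (\det (A + v *m v^T)) - ln (\det A).
Proof.
move=> pA; set s := dot v (invmx A *m v).
have s0 : 0 <= s by apply: posdef_invmx_ge0.
have /andP[dA _] := posdef_det_le_diag A pA; have uA := posdef_unitmx A pA.
have s1 : 0 < 1 + s by lra.
have inv_v : invmx (A + v *m v^T) *m v = (1 + s)^-1 *: (invmx A *m v).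
  have uA' := posdef_unitmx _ (posdef_rank1D A v pA).
  apply: (can_inj (mulKmx uA')); rewrite mulKVmx // -scalemxAr mulmxDl.
  rewrite rank1_mulmx mulKVmx // -/s.
  have -> : v + s *: v = (1 + s) *: v by rewrite scalerDl scale1r.
  by rewrite scalerA mulVf ?gt_eqF // scale1r.
rewrite inv_v dotZr -/s det_rank1D // -/s lnM ?posrE // addrAC subrr add0r.
have := @le_ln1Dx R (- ((1 + s)^-1 * s)).
have -> : 1 + - ((1 + s)^-1 * s) = (1 + s)^-1 by field; rewrite gt_eqF.
rewrite lnV ?posrE // lerN2; apply; rewrite ltrN2 mulrC ltr_pdivrMr //; lra.
Qed.

Variables (T : nat) (eps : R) (A : nat -> 'M[R]_n) (g : nat -> 'cV[R]_n).
Hypothesis eps_gt0 : 0 < eps.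
Hypothesis A0 : A 0%N = eps%:M.
Hypothesis AS : forall t, (1 <= t <= T)%N -> A t = A t.-1 + g t *m (g t)^T.

Lemma ons_posdef t : (t <= T)%N -> posdef (A t).
Proof.
elim: t => [|t IH] tT; first by rewrite A0; apply: posdef_scalar.
by rewrite AS //=; apply: posdef_rank1D; apply: IH; apply: ltnW.
Qed.

Lemma ons_quad_sum_le_ln (G2 : R) : (forall t, (1 <= t <= T)%N -> dot (g t) (g t) <= G2) ->
  0 <= G2 ->
  \sum_(1 <= t < T.+1) dot (g t) (invmx (A t) *m g t)
    <= n%:R * ln (1 + T%:R * G2 / eps).
Proof.
move=> gG G0.
have sum_le t : (t <= T)%N -> \sum_(1 <= s < t.+1) dot (g s) (invmx (A s) *m g s)
    <= ln (\det (A t)) - ln (\det (A 0%N)).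
  elim: t => [|t IH] tT; first by rewrite big_geq // subrr.
  rewrite big_nat_recr //=; have := IH (ltnW tT).
  have := rank1D_quad_le_ln (A t) (g t.+1) (ons_posdef _ (ltnW tT)).
  by rewrite (AS t.+1) //=; lra.
have diag_le t i : (t <= T)%N -> A t i i <= eps + t%:R * G2.
  elim: t => [|t IH] tT; first by rewrite A0 mxE eqxx mul0r addr0.
  rewrite (AS t.+1) //= mxE; have := IH (ltnW tT); have := gG t.+1 tT.
  rewrite dotE (bigD1 i) //= => gi.
  have : 0 <= \sum_(j < n | j != i) g t.+1 j 0 * g t.+1 j 0.
    by rewrite sumr_ge0 // => j _; rewrite -expr2 sqr_ge0.
  rewrite !mxE big_ord1 mxE -natr1 mulrDl mul1r; lra.
have E0 : 0 < eps + T%:R * G2 by rewrite ltr_pwDl // mulr_ge0.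
have E1 : 0 < 1 + T%:R * G2 / eps.
  by rewrite ltr_pwDl // divr_ge0 ?mulr_ge0 // ltW.
have lnXn' (y : R) : 0 < y -> ln (y ^+ n) = n%:R * ln y.
  by move=> y0; rewrite lnXn // mulr_natl.
apply: le_trans (sum_le T (leqnn T)) _; rewrite A0 det_scalar lnXn' //.
have /andP[dA dle] := posdef_det_le_diag _ (ons_posdef _ (leqnn T)).
have : ln (\det (A T)) <= ln ((eps + T%:R * G2) ^+ n).
  rewrite ler_ln ?posrE ?exprn_gt0 //; apply: le_trans dle _.
  have -> : (eps + T%:R * G2) ^+ n = \prod_(i < n) (eps + T%:R * G2).
    by rewrite prodr_const card_ord.
  apply: ler_prod => i _.
  rewrite diag_le // andbT.
  have [_ /(_ (delta_mx i 0))] := ons_posdef _ (leqnn T).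
  rewrite /Anorm2 trmx_delta -rowE -colE !mxE => /(_ _)/ltW; apply.
  by apply/eqP => /matrixP/(_ i 0)/eqP; rewrite !mxE !eqxx oner_eq0.
rewrite lnXn' //.
have -> : eps + T%:R * G2 = eps * (1 + T%:R * G2 / eps).
  by field; rewrite gt_eqF.
by rewrite lnM ?posrE // mulrDr; lra.
Qed.

Lemma ons_regret Theta (gam D G2 : R) (w : nat -> 'cV[R]_n) u :
  convex_set_R Theta -> 0 < gam -> (0 < T)%N -> 0 <= G2 ->
  (forall t, (1 <= t <= T)%N -> dot (g t) (g t) <= G2) ->
  Theta u -> dot (w 1%N - u) (w 1%N - u) <= D ^+ 2 ->
  (forall t, (1 <= t < T)%N -> Theta (w t.+1) /\
     forall v, Theta v ->
       Anorm2 (A t) (w t - gam^-1 *: (invmx (A t) *m g t) - w t.+1)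
       <= Anorm2 (A t) (w t - gam^-1 *: (invmx (A t) *m g t) - v)) ->
  \sum_(1 <= t < T.+1)
     (dot (g t) (w t - u) - gam / 2 * dot (g t) (w t - u) ^+ 2)
  <= n%:R * ln (1 + T%:R * G2 / eps) / (2 * gam) + gam / 2 * eps * D ^+ 2.
Proof.
move=> cvx gam0 T0 G0 gG Tu w1 wS.
pose c t := dot (g t) (w t - u) - gam / 2 * dot (g t) (w t - u) ^+ 2.
pose q t := dot (g t) (invmx (A t) *m g t).
pose y t := w t - gam^-1 *: (invmx (A t) *m g t).
have step t : (1 <= t <= T)%N ->
    c t + gam / 2 * Anorm2 (A t) (y t - u)
    = gam / 2 * Anorm2 (A t.-1) (w t - u) + q t / (2 * gam).
  move=> tT; have /andP[_ tleT] := tT.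
  have pA := ons_posdef t tleT; have uA := posdef_unitmx _ pA.
  have -> : y t - u = w t - u - gam^-1 *: (invmx (A t) *m g t) by rewrite /y addrAC.
  rewrite (Anorm2B (A t) (w t - u) (_ *: _)); last by case: pA.
  rewrite !Anorm2E -!scalemxAr !mulKVmx // !dotZl !dotZr -!Anorm2E {1}AS //.
  rewrite Anorm2_rank1D (dotC (invmx _ *m _)) (dotC _ (g t)) -/(q t) /c.
  by field; rewrite gt_eqF.
have upto t : (t < T)%N -> \sum_(1 <= s < t.+1) c s + gam / 2 * Anorm2 (A t) (w t.+1 - u)
    <= \sum_(1 <= s < t.+1) q s / (2 * gam) + gam / 2 * eps * D ^+ 2.
  elim: t => [|t IH] tT.
    rewrite !big_geq // !add0r A0 Anorm2_scalar mulrA ler_pM2l //.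
    by rewrite !mulr_gt0 ?invr_gt0.
  rewrite !(big_nat_recr t.+1) //=.
  have tT' : (1 <= t.+1 <= T)%N by rewrite /= ltnW.
  have [Tw wmin] := wS t.+1 tT.
  have := Anorm2_proj_le _ _ u _ _ cvx (ons_posdef _ (ltnW tT)) Tw Tu wmin.
  rewrite -/(y t.+1) -(ler_pM2l (_ : 0 < gam / 2)); last by rewrite divr_gt0.
  by have := IH (ltnW tT); have := step _ tT'; rewrite /=; lra.
have := upto T.-1; rewrite prednK // leqnn => /(_ isT).
have TT : (1 <= T <= T)%N by rewrite T0 /=.
have := step T TT; have := posdef_ge0 _ (y T - u) (ons_posdef _ (leqnn T)).
rewrite -(pmulr_rge0 _ (_ : 0 < gam / 2)); last by rewrite divr_gt0.
have := ons_quad_sum_le_ln G2 gG G0.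
rewrite -(ler_pM2r (_ : 0 < (2 * gam)^-1)); last by rewrite invr_gt0 mulr_gt0.
rewrite !(big_nat_recr T) //= -/(q T) -/(c T) mulrDl mulr_suml; rewrite /q /c; lra.
Qed.

End OnlineNewtonStep.

Section ExponentialWeights.
Context {R : realType}.

Lemma expR_subsqr_le (x : R) : - (1 / 4) <= x -> expR (x - x ^+ 2) <= 1 + x.
Proof.
move=> xge; have x1 : 0 < 1 + x by lra.
have -> : x - x ^+ 2 = - (x ^+ 2 - x) by ring.
pose y := x ^+ 2 - x.
rewrite expRN -/y -[X in X <= _]mul1r ler_pdivrMr ?expR_gt0 //.
have sq : 1 + y + y ^+ 2 / 4 <= expR y.
  have -> : expR y = expR (y / 2) ^+ 2 by rewrite -expRM_natl; congr expR; field.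
  have -> : 1 + y + y ^+ 2 / 4 = (1 + y / 2) ^+ 2 by field.
  by rewrite ler_pXn2r ?nnegrE ?expR_ge0 ?expR_ge1Dx // /y; nra.
have [x0|x0] := leP 0 x.
  by have := expR_ge1Dx y; rewrite /y; nra.
have key : - (4 * x) <= (1 + x) * (1 - x) ^+ 2 by nra.
apply: le_trans (_ : (1 + x) * (1 + y + y ^+ 2 / 4) <= _); last by rewrite ler_pM2l.
have -> : (1 + x) * (1 + y + y ^+ 2 / 4)
    = 1 + x ^+ 2 * ((1 + x) * (1 - x) ^+ 2 + 4 * x) / 4 by rewrite /y; field.
by rewrite lerDl divr_ge0 // mulr_ge0 ?sqr_ge0 //; lra.
Qed.

Variables (N T : nat) (p f : nat -> nat -> R).
Let Z t := \sum_(j < N.+1) p j t * expR (- f j t).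
Hypothesis pS : forall i t, (i <= N)%N -> (1 <= t < T)%N ->
  p i t.+1 = p i t * expR (- f i t) / Z t.
Hypothesis p1_gt0 : forall i, (i <= N)%N -> 0 < p i 1%N.

Lemma weights_Z_gt0 t : (forall i, (i <= N)%N -> 0 < p i t) -> 0 < Z t.
Proof.
move=> p0; rewrite /Z big_ord_recl ltr_pwDl //.
  by rewrite mulr_gt0 ?expR_gt0 ?p0.
by rewrite sumr_ge0 // => i _; rewrite mulr_ge0 ?expR_ge0 // ltW // p0 // lift0.
Qed.

Lemma weights_gt0 t i : (1 <= t <= T)%N -> (i <= N)%N -> 0 < p i t.
Proof.
case: t => // t; elim: t i => [|t IH] i tT iN; first exact: p1_gt0.
have tT' : (1 <= t.+1 <= T)%N by rewrite /= ltnW.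
rewrite pS // divr_gt0 ?mulr_gt0 ?expR_gt0 ?IH //.
by apply: weights_Z_gt0 => j jN; apply: IH.
Qed.

Lemma weights_potential i : (0 < T)%N -> (i <= N)%N ->
  (forall t, (1 <= t <= T)%N -> Z t <= 1) ->
  p i 1%N * expR (- \sum_(1 <= t < T.+1) f i t) <= 1.
Proof.
move=> T0 iN Z1.
have peZ t : (1 <= t <= T)%N -> p i t * expR (- f i t) <= Z t.
  move=> tT; rewrite /Z (bigD1 (Ordinal (iN : i < N.+1)%N)) //= lerDl.
  rewrite sumr_ge0 // => j _; rewrite mulr_ge0 ?expR_ge0 // ltW //.
  by rewrite weights_gt0 // -ltnS.
have upto t : (t < T)%N ->
    p i 1%N * expR (- \sum_(1 <= s < t.+1) f i s) <= p i t.+1.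
  elim: t => [|t IH] tT; first by rewrite big_geq // oppr0 expR0 mulr1.
  have tT' : (1 <= t.+1 <= T)%N by rewrite /= ltnW.
  rewrite big_nat_recr //= opprD expRD mulrA (pS i t.+1) //.
  apply: le_trans (_ : p i t.+1 * expR (- f i t.+1) <= _).
    by rewrite ler_pM2r ?expR_gt0 //; apply/IH/ltnW.
  rewrite ler_pdivlMr; last by apply: weights_Z_gt0 => j; apply: weights_gt0.
  by rewrite ler_piMr ?Z1 // mulr_ge0 ?expR_ge0 // ltW // weights_gt0.
have TT : (1 <= T <= T)%N by rewrite T0 /=.
have := upto T.-1; rewrite prednK // leqnn => /(_ isT) H.
rewrite big_nat_recr //= opprD expRD mulrA.
apply: le_trans (_ : p i T * expR (- f i T) <= _); first by rewrite ler_pM2r ?expR_gt0.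
by apply: le_trans (peZ T TT) _; apply: Z1.
Qed.

Lemma weights_sum1 t : \sum_(i < N.+1) p i 1%N = 1 -> (1 <= t <= T)%N ->
  \sum_(i < N.+1) p i t = 1.
Proof.
move=> s1; case: t => // -[//|t] tT; have tT' : (1 <= t.+1 <= T)%N by rewrite /= ltnW.
under eq_bigr => i _ do rewrite pS ?leq_ord //.
rewrite -mulr_suml -/(Z t.+1) mulfV // gt_eqF //.
by apply: weights_Z_gt0 => j; apply: weights_gt0.
Qed.

End ExponentialWeights.

Lemma convex_set_R_sum {R : realType} {n : nat} (S : set 'cV[R]_n) N
    (a : nat -> R) (w : nat -> 'cV[R]_n) :
  convex_set_R S -> (forall i, (i <= N)%N -> 0 < a i) ->
  (forall i, (i <= N)%N -> S (w i)) ->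
  S ((\sum_(i < N.+1) a i)^-1 *: \sum_(i < N.+1) a i *: w i).
Proof.
move=> cvx; elim: N => [|N IH] a0 Sw.
  by rewrite !big_ord1 scalerA mulVf ?gt_eqF ?a0 // scale1r; apply: Sw.
rewrite big_ord_recr [in X in _ *: X]big_ord_recr /=.
set s := \sum_(i < N.+1) a i; set v := \sum_(i < N.+1) a i *: w i.
have aN : 0 < a N.+1 by apply: a0.
have s0 : 0 < s.
  rewrite /s big_ord_recl ltr_pwDl ?a0 // sumr_ge0 // => i _.
  exact/ltW/a0/ltnW/ltn_ord.
have -> : (s + a N.+1)^-1 *: (v + a N.+1 *: w N.+1)
    = (s / (s + a N.+1)) *: (s^-1 *: v) + (1 - s / (s + a N.+1)) *: w N.+1.
  rewrite scalerDr !scalerA; congr (_ *: _ + _ *: _).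
    by field; rewrite !gt_eqF ?addr_gt0.
  by field; rewrite !gt_eqF ?addr_gt0.
apply: cvx; [|exact: Sw|].
  by apply: IH => i iN; [apply: a0|apply: Sw]; apply: ltnW.
by rewrite divr_ge0 ?ler_pdivrMr ?mul1r ?addr_gt0 // ?lerDl ltW // addr_gt0.
Qed.

Section Tuning.
Context {R : realType}.

Lemma expR1_le4 : expR 1 <= 4 :> R.
Proof.
have := @expR_ge1Dx R (- 2^-1); rewrite expRN.
have -> : expR 1 = expR 2^-1 ^+ 2 :> R by rewrite -expRM_natl mulfV.
have := @expR_gt0 R 2^-1; set e := expR _ => e0.
rewrite -[X in _ <= X]mul1r ler_pdivlMr // => e2.
have : e <= 2 by lra.
by nra.
Qed.

Lemma mg_N_ge T : (0 < T)%N -> T%:R <= 4 ^+ mg_N R T :> R.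
Proof.
move=> T0; have T0' : 0 < T%:R :> R by rewrite ltr0n.
have ln20 : 0 < ln (2 : R) by rewrite ln_gt0 // ltr1n.
rewrite -ler_ln ?posrE ?exprn_gt0 // lnXn // -[_ *+ mg_N R T]mulr_natl.
have -> : ln (4 : R) = 2 * ln 2.
  by rewrite (_ : 4 = 2 ^+ 2) ?lnXn // ?mulr_natl // -natrX.
rewrite -ler_pdivrMr ?mulr_gt0 //; apply: le_trans (ceil_ge _) _.
by rewrite /mg_N -[X in _ <= X]/((Posz _)%:~R) ler_int abszE ler_norm.
Qed.

Lemma mg_prior_gt0 T i : 0 < mg_prior R T i.
Proof. by rewrite /mg_prior /mg_C divr_gt0 ?addr_gt0 ?mulr_gt0 ?invr_gt0. Qed.

Lemma mg_prior_sum T : \sum_(i < (mg_N R T).+1) mg_prior R T i = 1.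
Proof.
rewrite /mg_prior -mulr_sumr /mg_C; move: (mg_N R T) => N.
have tele m : \sum_(i < m) (i.+1%:R * i.+2%:R)^-1 = m%:R / m.+1%:R :> R.
  elim: m => [|m IH]; first by rewrite big_ord0 mul0r.
  rewrite big_ord_recr /= IH -(natr1 m.+1) -(natr1 m); field.
  have m0 : 0 <= m%:R :> R by [].
  by apply/andP; split; rewrite gt_eqF //; lra.
rewrite tele -(natr1 N.+1) -(natr1 N); field.
have N0 : 0 <= N%:R :> R by [].
by apply/andP; split; rewrite gt_eqF //; lra.
Qed.

Lemma mg_prior_ln_le T i : - ln (mg_prior R T i) <= 2 * i%:R + 1.
Proof.
have le_ln (x : R) : 0 < x -> ln x <= x - 1.
  by move=> x0; have := @le_ln1Dx R (x - 1); rewrite subrKC; apply; lra.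
have i0 : 0 <= i%:R :> R by [].
have C1 : 1 <= mg_C R T by rewrite /mg_C lerDl divr_ge0.
have C0 : 0 < mg_C R T by lra.
rewrite /mg_prior ln_div ?posrE ?mulr_gt0 // lnM ?posrE //.
have := ln_ge0 C1; have := le_ln _ (ltr0Sn R i); have := le_ln _ (ltr0Sn R i.+1).
rewrite -(natr1 i.+1) -(natr1 i); lra.
Qed.

Lemma mg_eta_gt0 (B : R) i : 0 < B -> 0 < mg_eta B i.
Proof. by move=> B0; rewrite /mg_eta divr_gt0 ?invr_gt0 ?exprn_gt0 ?mulr_gt0. Qed.

Lemma mg_eta_le (B : R) i : 0 < B -> mg_eta B i * B <= 1 / 5.
Proof.
move=> B0; have -> : mg_eta B i * B = 2 ^- i / 5.
  by rewrite /mg_eta; field; rewrite ?expf_neq0 // gt_eqF.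
by rewrite ler_pM2r ?invr_gt0 // invf_le1 ?exprn_gt0 // exprn_ege1 // ler1n.
Qed.

(* The grid rate used is the one with [4 ^+ i <= V / (B ^+ 2 * n * L) < 4 ^+ i.+1]; the bound [V <= B ^+ 2 * n * expR L] keeps [i <= L], so that the cost [2 * i + 1] of the prior is absorbed by [n * L]. *)
Lemma mg_tuning (B V L Rt : R) (n T N : nat) :
  0 < B -> (0 < n)%N -> 1 <= L -> 0 <= V ->
  V <= B ^+ 2 * T%:R -> V <= B ^+ 2 * n%:R * expR L -> T%:R <= 4 ^+ N :> R ->
  (forall i, (i <= N)%N -> mg_eta B i * Rt
     <= mg_eta B i ^+ 2 * V + (n%:R * (1 + 2 * L) + 2 * i%:R + 1)) ->
  Rt <= 31 * (B * n%:R * L + Num.sqrt (V * (n%:R * L))).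
Proof.
move=> B0 n0 L1 V0 VT VL TN eta_le; pose a := n%:R * L.
have n1 : 1 <= n%:R :> R by rewrite ler1n.
have nL : n%:R <= a by rewrite /a ler_peMr.
have La : L <= a by rewrite /a ler_peMl //; lra.
have a1 : 1 <= a by lra.
have a0 : 0 < a by lra.
set S := Num.sqrt _; have S0 : 0 <= S by apply: sqrtr_ge0.
have S2 : S ^+ 2 = V * a by rewrite sqr_sqrtr // mulr_ge0 // ltW.
have B20 : 0 < B ^+ 2 by rewrite exprn_gt0.
have rate i : (i <= N)%N -> i%:R <= L ->
    5 * 2 ^+ i * B * Rt <= V + 6 * a * (25 * (2 ^+ i) ^+ 2 * B ^+ 2).
  move=> iN iL; have := eta_le i iN; have p0 : 0 < 2 ^+ i :> R by rewrite exprn_gt0.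
  rewrite /mg_eta; move: p0; set p := 2 ^+ i => p0.
  have q0 : 0 < 25 * p ^+ 2 * B ^+ 2 by rewrite !mulr_gt0 ?exprn_gt0.
  have pB : p != 0 /\ B != 0 by rewrite !gt_eqF.
  rewrite -(ler_pM2l q0).
  have -> : 25 * p ^+ 2 * B ^+ 2 * (p^-1 / (5 * B) * Rt) = 5 * p * B * Rt.
    by field; case: pB => -> ->.
  rewrite [X in _ <= X]mulrDr.
  have -> : 25 * p ^+ 2 * B ^+ 2 * ((p^-1 / (5 * B)) ^+ 2 * V) = V.
    by field; case: pB => -> ->.
  move=> H; apply: le_trans H _; rewrite lerD2l mulrC ler_pM2r //.
  have -> : n%:R * (1 + 2 * L) = n%:R + 2 * a by rewrite /a; ring.
  lra.
have -> : B * n%:R * L = B * a by rewrite /a mulrA.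
have Ba0 : 0 < B * a by rewrite mulr_gt0.
have [Vsmall|Vbig] := ltP V (B ^+ 2 * a).
  have := rate 0%N (leq0n N) (le_trans ler01 L1); rewrite expr0 expr1n => H.
  apply: le_trans (_ : 31 * (B * a) <= _); last by lra.
  by rewrite -(ler_pM2l (_ : 0 < 5 * B)) ?mulr_gt0 //; lra.
have VN : V < 4 ^+ N.+1 * (B ^+ 2 * a).
  have := ler_wpM2l (ltW B20) TN; have := VT.
  have : 0 < B ^+ 2 * 4 ^+ N by rewrite mulr_gt0 ?exprn_gt0.
  rewrite (exprS 4); move: (4 ^+ N) => Y Y0 VT' TY.
  have := ler_wpM2l (ltW Y0) a1; lra.
have ex_j : exists j, V < 4 ^+ j * (B ^+ 2 * a) by exists N.+1.
have [[|i]] := ex_minnP ex_j; first by rewrite expr0 mul1r ltNge Vbig.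
move=> Vlt imin.
have iN : (i <= N)%N by rewrite -ltnS imin.
have Vge : 4 ^+ i * (B ^+ 2 * a) <= V.
  by rewrite leNgt; apply/negP => /imin; rewrite ltnn.
have iL : i%:R <= L.
  rewrite -ler_expR -[i%:R]mulr1 expRM_natl.
  apply: le_trans (_ : 4 ^+ i <= _).
    by rewrite lerXn2r ?nnegrE ?expR_ge0 ?expR1_le4.
  rewrite -(ler_pM2r (mulr_gt0 B20 a0)).
  apply: le_trans Vge _; apply: le_trans VL _.
  by rewrite mulrC ler_pM2l ?expR_gt0 // ler_pM2l.
have := rate i iN iL; move: Vlt Vge; rewrite (exprS 4).
have -> : 4 ^+ i = (2 ^+ i) ^+ 2 :> R by rewrite -exprM mulnC exprM expr2 -natrM.
have : 0 < 2 ^+ i :> R by rewrite exprn_gt0.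
move: (2 ^+ i) => p p0 Vlt Vge rate_i; have pB : 0 < p * B by rewrite mulr_gt0.
have pBa : p * B * a <= S.
  have pBa0 : 0 <= p * B * a by rewrite ltW // mulr_gt0.
  rewrite -ler_sqr ?nnegrE // S2.
  have := ler_wpM2r (ltW a0) Vge; lra.
have VS : V <= 2 * (p * B * S).
  have pBS0 : 0 <= 2 * (p * B * S) by rewrite mulr_ge0 // mulr_ge0 // ltW.
  rewrite -ler_sqr ?nnegrE //.
  have -> : (2 * (p * B * S)) ^+ 2 = 4 * (p * B) ^+ 2 * S ^+ 2 by ring.
  by rewrite S2; have := ler_wpM2l V0 (ltW Vlt); lra.
apply: le_trans (_ : 31 * S <= _); last by lra.
rewrite -(ler_pM2l (_ : 0 < 5 * (p * B))) ?mulr_gt0 //.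
have := ler_wpM2l (ltW pB) pBa; have := mulr_ge0 (ltW pB) S0; lra.
Qed.

Lemma self_bounding_le (b q s Rt Delta : R) :
  0 <= b -> 0 <= q -> 0 <= s -> q ^+ 2 = b * Delta ->
  s ^+ 2 <= b * (Rt + 2 * Delta) ->
  Rt <= 31 * (b + s) -> Rt <= 1023 * (b + q).
Proof.
move=> b0 q0 s0 q2 s2 Rs.
have s2' : s ^+ 2 <= 31 * b ^+ 2 + 31 * b * s + 2 * q ^+ 2.
  by apply: le_trans s2 _; rewrite q2; have := ler_wpM2l b0 Rs; lra.
have : s <= 32 * b + 2 * q; last by lra.
by rewrite leNgt; apply/negP => sgt; nra.
Qed.

End Tuning.

Section Surrogate.
Context {R : realType} {n : nat}.
Implicit Types (c g u v w x y : 'cV[R]_n) (Theta X : set 'cV[R]_n).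

Lemma diam_le_sqr X (d : R) u v :
  0 <= d -> diam_le X d -> X u -> X v -> dot (u - v) (u - v) <= d ^+ 2.
Proof.
move=> d0 dX Xu Xv; rewrite -[leLHS]sqr_sqrtr ?dot_ge0 //.
by rewrite ler_sqr ?nnegrE ?sqrtr_ge0 // dX.
Qed.

Lemma subopt_loss_ge X (K : R) x y c :
  diam_le X K -> X x -> X y -> dot c (y - x) <= subopt_loss X x c.
Proof.
move=> dX Xx Xy; rewrite /subopt_loss dotBr lerD2r.
apply: ub_le_sup; last by exists y.
exists (dot c x + l2norm c * K) => _ [z Xz <-].
have -> : z = x + (z - x) by rewrite addrC subrK.
rewrite dotDr lerD2l; apply: le_trans (dot_le_l2norm _ _) _.
by rewrite ler_wpM2l ?sqrtr_ge0 // dX.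
Qed.

Lemma surr_gradE (eta : R) c g w :
  surr_grad eta c g w = (eta * (1 - 2 * eta * dot (c - w) g)) *: g.
Proof. by rewrite /surr_grad -scalerBl; congr (_ *: _); ring. Qed.

(* The surrogate loss is quadratic along [g], hence exp-concave as far as its slope is controlled. *)
Lemma surr_loss_diff_le (eta gam : R) c g u w :
  gam * (1 - 2 * eta * dot (c - w) g) ^+ 2 <= 2 ->
  surr_loss eta c g w - surr_loss eta c g u
    <= dot (surr_grad eta c g w) (w - u)
       - gam / 2 * dot (surr_grad eta c g w) (w - u) ^+ 2.
Proof.
rewrite surr_gradE dotZl (dotC g) /surr_loss.
have -> : w - u = (c - u) - (c - w) by rewrite opprB [RHS]addrC subrKA.
rewrite [dot (_ - _ - _) _]dotBl.
move: (dot (c - w) g) (dot (c - u) g) => a b.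
set m := 1 - 2 * eta * a => mle.
have : 0 <= (eta * (b - a)) ^+ 2 * (1 - gam * m ^+ 2 / 2).
  by rewrite mulr_ge0 ?sqr_ge0 //; lra.
by rewrite /m; lra.
Qed.

Lemma mg_expert_regret (Theta : set 'cV[R]_n) (B D K : R) (T i : nat) u
    (chat g w : nat -> 'cV[R]_n) (A : nat -> 'M[R]_n) :
  let eta := mg_eta B i in let gam := mg_gamma B i in
  let grad t := surr_grad eta (chat t) (g t) (w t) in
  (0 < n <= T)%N -> 0 < B -> 0 < D -> 0 < K ->
  expR 1 <= D * K * T%:R / (B * n%:R) ->
  convex_set_R Theta -> Theta u ->
  dot (w 1%N - u) (w 1%N - u) <= D ^+ 2 ->
  (forall t, (1 <= t <= T)%N -> dot (g t) (g t) <= K ^+ 2) ->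
  (forall t, (1 <= t <= T)%N -> `|dot (chat t - w t) (g t)| <= B) ->
  A 0%N = (ons_eps n D gam)%:M ->
  (forall t, (1 <= t <= T)%N -> A t = A t.-1 + grad t *m (grad t)^T) ->
  (forall t, (1 <= t < T)%N -> Theta (w t.+1) /\
     forall v, Theta v ->
       Anorm2 (A t) (w t - gam^-1 *: (invmx (A t) *m grad t) - w t.+1)
       <= Anorm2 (A t) (w t - gam^-1 *: (invmx (A t) *m grad t) - v)) ->
  \sum_(1 <= t < T.+1) surr_loss eta (chat t) (g t) (w t)
    - \sum_(1 <= t < T.+1) surr_loss eta (chat t) (g t) u
  <= n%:R * (1 + 2 * ln (D * K * T%:R / (B * n%:R))).
Proof.
move=> eta gam grad /andP[n0 nT] B0 D0 K0; set z := D * K * T%:R / (B * n%:R).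
move=> ez cvx Tu w1 gK cB A0 AS wS.
have eta0 : 0 < eta := mg_eta_gt0 B i B0.
have etaB : eta * B <= 1 / 5 := mg_eta_le B i B0.
have etaB0 : 0 < eta * B by rewrite mulr_gt0.
pose h := 1 + 2 * (eta * B); have h1 : 1 < h by rewrite /h; lra.
have h2 : h ^+ 2 <= 2 by rewrite /h; nra.
have h0 : h != 0 by rewrite gt_eqF //; lra.
have gamE : gam = (h ^+ 2)^-1 by rewrite /gam /mg_gamma div1r /h mulrA.
have hpos : 0 < h ^+ 2 by rewrite exprn_gt0 //; lra.
have gam0 : 0 < gam by rewrite gamE invr_gt0.
have n0' : 0 < n%:R :> R by rewrite ltr0n.
have T0' : 0 < T%:R :> R by rewrite ltr0n (leq_trans n0).
have nT' : n%:R <= T%:R :> R by rewrite ler_nat.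
have slope t : (1 <= t <= T)%N ->
    (1 - 2 * eta * dot (chat t - w t) (g t)) ^+ 2 <= h ^+ 2.
  move=> /cB; rewrite ler_norml => /andP[l1 l2].
  have := ler_wpM2l (ltW eta0) l1; have := ler_wpM2l (ltW eta0) l2.
  by rewrite /h; nra.
have eps0 : 0 < ons_eps n D gam by rewrite divr_gt0 // mulr_gt0 ?exprn_gt0.
pose G2 := eta ^+ 2 * h ^+ 2 * K ^+ 2.
have G20 : 0 <= G2 by rewrite /G2 -!exprMn sqr_ge0.
have gradG t : (1 <= t <= T)%N -> dot (grad t) (grad t) <= G2.
  move=> tT; rewrite /grad surr_gradE dotZl dotZr mulrA -expr2 exprMn.
  apply: ler_pM; [by rewrite -exprMn sqr_ge0|exact: dot_ge0| |exact: gK].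
  by rewrite ler_wpM2l ?sqr_ge0 ?slope.
have Tpos : (0 < T)%N := leq_trans n0 nT.
have := ons_regret T _ A grad eps0 A0 AS Theta gam D G2 w u cvx gam0 Tpos G20
          gradG Tu w1 wS.
rewrite -sumrB => reg; apply: le_trans (le_trans _ reg) _.
  rewrite big_nat_cond [leRHS]big_nat_cond; apply: ler_sum => t /andP[tT _].
  apply: surr_loss_diff_le; rewrite gamE mulrC ler_pdivrMr //.
  by apply: le_trans (slope t tT) _; lra.
have -> : gam / 2 * ons_eps n D gam * D ^+ 2 = n%:R * (h ^+ 2 / 2).
  by rewrite /ons_eps gamE; field; rewrite h0 gt_eqF.
have -> : n%:R * ln (1 + T%:R * G2 / ons_eps n D gam) / (2 * gam)
   = n%:R * ((h ^+ 2 / 2) * ln (1 + T%:R * G2 / ons_eps n D gam)).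
  by rewrite gamE; field.
have z2 : 2 <= z by have := @expR_ge1Dx R 1; lra.
have z0 : 0 < z by lra.
have arg_le : T%:R * G2 / ons_eps n D gam <= z ^+ 2 / 25.
  pose q : R := T%:R / n%:R; have q1 : 1 <= q by rewrite ler_pdivlMr // mul1r.
  have -> : T%:R * G2 / ons_eps n D gam
      = q * (eta * B) ^+ 2 * gam * (K * D / B) ^+ 2.
    rewrite /q /G2 /ons_eps gamE; field.
    by rewrite h0 !gt_eqF.
  have -> : z ^+ 2 / 25 = q ^+ 2 / 25 * (K * D / B) ^+ 2.
    by rewrite /q /z; field; rewrite !gt_eqF.
  rewrite ler_wpM2r ?sqr_ge0 //.
  have gam1 : gam <= 1 by rewrite gamE invf_le1 // exprn_ege1 // ltW.
  have y2 : (eta * B) ^+ 2 <= 1 / 25 by nra.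
  have qy0 : 0 <= q * (eta * B) ^+ 2 by rewrite mulr_ge0 ?sqr_ge0 //; lra.
  apply: le_trans (_ : q * (eta * B) ^+ 2 <= _); first by rewrite ler_piMr.
  by have := ler_wpM2l (_ : 0 <= q) y2; nra.
have arg0 : 0 <= T%:R * G2 / ons_eps n D gam.
  by apply: divr_ge0; [apply: mulr_ge0|apply: ltW].
have ln_le : ln (1 + T%:R * G2 / ons_eps n D gam) <= 2 * ln z.
  have -> : 2 * ln z = ln (z ^+ 2) by rewrite lnXn // mulr_natl.
  rewrite ler_ln ?posrE ?exprn_gt0 //; last by lra.
  by nra.
have ln0 : 0 <= ln (1 + T%:R * G2 / ons_eps n D gam) by rewrite ln_ge0 //; lra.
rewrite -mulrDr ler_pM2l //; nra.
Qed.

End Surrogate.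

Theorem theorem2 :
  exists C0 : nat,
  forall (R : realType) (n T : nat) (Theta : set 'cV[R]_n) (cstar : 'cV[R]_n)
    (X : nat -> set 'cV[R]_n) (x : nat -> 'cV[R]_n) (D K B : R)
    (chat xhat : nat -> 'cV[R]_n)
    (w : nat -> nat -> 'cV[R]_n) (A : nat -> nat -> 'M[R]_n)
    (p : nat -> nat -> R),
  (0 < n)%N -> (0 < T)%N ->
  closed Theta -> convex_set_R Theta -> Theta cstar ->
  (forall t, (1 <= t <= T)%N -> X t !=set0 /\ compact (X t) /\ X t (x t)) ->
  0 < D -> diam_le Theta D ->
  0 < K -> (forall t, (1 <= t <= T)%N -> diam_le (X t) K) ->
  0 < B ->
  (forall t, (1 <= t <= T)%N -> forall c c' y y',
      Theta c -> Theta c' -> X t y -> X t y' -> dot (c - c') (y - y') <= B) ->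
  (* regime in which ln(DKT/(Bn)) >= 1 (see NOTES.md) *)
  expR 1 * (B * n%:R) <= D * K * T%:R ->
  (* ---- MetaGrad run (W = D, G = K, H = B), experts i = 0..mg_N R T ---- *)
  (forall i, (i <= mg_N R T)%N ->
     [/\ p i 1%N = mg_prior R T i,
         A i 0%N = (ons_eps n D (mg_gamma B i))%:M
       & Theta (w i 1%N)]) ->
  (forall t, (1 <= t <= T)%N ->
     chat t = (\sum_(i < (mg_N R T).+1) mg_eta B i * p i t)^-1 *:
              \sum_(i < (mg_N R T).+1) (mg_eta B i * p i t) *: w i t) ->
  (forall t, (1 <= t <= T)%N -> is_argmax_lin (X t) (chat t) (xhat t)) ->
  (* ONS update of each eta-expert on its surrogate losses, g_t = xhat_t - x_t *)
  (forall i t, (i <= mg_N R T)%N -> (1 <= t <= T)%N ->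
     A i t = A i t.-1 +
       surr_grad (mg_eta B i) (chat t) (xhat t - x t) (w i t) *m
       (surr_grad (mg_eta B i) (chat t) (xhat t - x t) (w i t))^T) ->
  (forall i t, (i <= mg_N R T)%N -> (1 <= t < T)%N ->
     Theta (w i t.+1) /\
     forall v, Theta v ->
       Anorm2 (A i t) (w i t - (mg_gamma B i)^-1 *: (invmx (A i t) *m
                 surr_grad (mg_eta B i) (chat t) (xhat t - x t) (w i t))
                 - w i t.+1)
       <= Anorm2 (A i t) (w i t - (mg_gamma B i)^-1 *: (invmx (A i t) *m
                 surr_grad (mg_eta B i) (chat t) (xhat t - x t) (w i t))
                 - v)) ->
  (forall i t, (i <= mg_N R T)%N -> (1 <= t < T)%N ->
     p i t.+1 =
       p i t * expR (- surr_loss (mg_eta B i) (chat t) (xhat t - x t) (w i t))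
       / \sum_(j < (mg_N R T).+1)
           p j t * expR (- surr_loss (mg_eta B j) (chat t) (xhat t - x t) (w j t))) ->
  let Delta := \sum_(1 <= t < T.+1) subopt_loss (X t) (x t) cstar in
  let L := ln (D * K * T%:R / (B * n%:R)) in
  \sum_(1 <= t < T.+1) dot cstar (x t - xhat t)
    <= \sum_(1 <= t < T.+1) dot (chat t - cstar) (xhat t - x t)
  /\ \sum_(1 <= t < T.+1) dot (chat t - cstar) (xhat t - x t)
    <= C0%:R * (B * n%:R * L + Num.sqrt (Delta * B * n%:R * L)).
Proof.
exists 1023%N => R n T Theta cstar X x D K B chat xhat w A p n0 T0 _ cvx Tcs HX.
move=> D0 dD K0 dK B0 HB Hz Hinit Hchat Hxhat HA Hw Hp Delta L.
pose g t := xhat t - x t; pose r t := dot (chat t - cstar) (g t).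
have n0' : 0 < n%:R :> R by rewrite ltr0n.
have T0' : 0 < T%:R :> R by rewrite ltr0n.
have Xx t : (1 <= t <= T)%N -> X t (x t) by move=> /HX[_ []].
have Xxhat t : (1 <= t <= T)%N -> X t (xhat t) by move=> /Hxhat[].
split.
  rewrite big_nat_cond [leRHS]big_nat_cond; apply: ler_sum => t /andP[tT _].
  have [_ /(_ _ (Xx t tT))] := Hxhat t tT.
  by rewrite dotBl !dotBr; lra.
rewrite -/(\sum_(1 <= t < T.+1) r t); set Rt := \sum_(1 <= t < T.+1) r t.
have z0 : 0 < B * n%:R by rewrite mulr_gt0.
have ez : expR 1 <= D * K * T%:R / (B * n%:R) by rewrite ler_pdivlMr.
have L1 : 1 <= L by rewrite -ler_expR lnK // posrE (lt_le_trans (expR_gt0 1)).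
have eL : expR L = D * K * T%:R / (B * n%:R).
  by rewrite lnK // posrE (lt_le_trans (expR_gt0 1)).
pose f i t := surr_loss (mg_eta B i) (chat t) (g t) (w i t).
have p1_gt0 i : (i <= mg_N R T)%N -> 0 < p i 1%N.
  by move=> iN; have [-> _ _] := Hinit i iN; apply: mg_prior_gt0.
have p_gt0 t i := weights_gt0 (mg_N R T) T p f Hp p1_gt0 t i.
have ep_gt0 t i : (1 <= t <= T)%N -> (i <= mg_N R T)%N -> 0 < mg_eta B i * p i t.
  by move=> tT iN; apply: mulr_gt0 (mg_eta_gt0 _ _ B0) (p_gt0 t i tT iN).
have p_sum t : (1 <= t <= T)%N -> \sum_(i < (mg_N R T).+1) p i t = 1.
  apply: (weights_sum1 _ _ _ f) => //.
  rewrite -[RHS](mg_prior_sum T); apply: eq_bigr => i _.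
  by have [] := Hinit i (leq_ord i).
have Tw i t : (i <= mg_N R T)%N -> (1 <= t <= T)%N -> Theta (w i t).
  case: t => // -[|t] iN tT; first by have [] := Hinit i iN.
  by have [] := Hw i t.+1 iN tT.
have Tchat t : (1 <= t <= T)%N -> Theta (chat t).
  move=> tT; rewrite Hchat //.
  apply: (convex_set_R_sum _ _ (fun i => mg_eta B i * p i t) (fun i => w i t)) => //.
    by move=> i iN; apply: ep_gt0.
  by move=> i iN; apply: Tw.
have gB t c c' : (1 <= t <= T)%N -> Theta c -> Theta c' -> `|dot (c - c') (g t)| <= B.
  move=> tT Tc Tc'; rewrite ler_norml lerNl -dotNl opprB.
  by rewrite !(HB t tT) //; [exact: Xxhat|exact: Xx|exact: Xxhat|exact: Xx].
have gK t : (1 <= t <= T)%N -> dot (g t) (g t) <= K ^+ 2.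
  by move=> tT; apply: (diam_le_sqr (X t)); rewrite ?(ltW K0) //; auto.
have rDK t : (1 <= t <= T)%N -> `|r t| <= D * K.
  move=> tT; have norm_le u : l2norm u <= D -> dot u (g t) <= D * K.
    move=> uD; apply: le_trans (dot_le_l2norm _ _) _.
    by apply: ler_pM; rewrite ?sqrtr_ge0 //; apply: dK; auto.
  rewrite ler_norml lerNl -dotNl opprB.
  by rewrite !norm_le //; apply: dD => //; apply: Tchat.
have Z_le1 t : (1 <= t <= T)%N ->
    \sum_(i < (mg_N R T).+1) p i t * expR (- f i t) <= 1.
  move=> tT; have Schat : \sum_(i < (mg_N R T).+1) (mg_eta B i * p i t) *: w i t
      = (\sum_(i < (mg_N R T).+1) mg_eta B i * p i t) *: chat t.
    rewrite Hchat // scalerA mulfV ?scale1r // gt_eqF //.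
    rewrite big_ord_recl ltr_pwDl ?ep_gt0 //.
    by apply: sumr_ge0 => i _; rewrite ltW // ep_gt0 // leq_ord.
  pose s i := mg_eta B i * dot (chat t - w i t) (g t).
  apply: le_trans (_ : \sum_(i < (mg_N R T).+1) p i t * (1 + s i) <= _).
    apply: ler_sum => i _; rewrite ler_pM2l ?p_gt0 ?leq_ord //.
    have -> : - f i t = s i - s i ^+ 2 by rewrite /f /s /surr_loss; ring.
    apply: expR_subsqr_le; have := gB t _ _ tT (Tchat t tT) (Tw i t (leq_ord i) tT).
    rewrite ler_norml => /andP[/(ler_wpM2l (ltW (mg_eta_gt0 B i B0)))].
    by have := mg_eta_le B i B0; rewrite /s; lra.
  under eq_bigr => i _ do rewrite mulrDr mulr1.
  rewrite big_split /= p_sum // gerDl.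
  set S := \sum_(i < (mg_N R T).+1) mg_eta B i * p i t in Schat.
  under eq_bigr => i _ do rewrite /s dotBl mulrA (mulrC (p i t)) mulrBr.
  rewrite sumrB -mulr_suml.
  under [X in _ - X]eq_bigr => i _ do rewrite -dotZl.
  by rewrite -(dot_suml _ (fun i => (mg_eta B i * p i t) *: w i t)) Schat dotZl subrr.
have Delta_ge t : (1 <= t <= T)%N -> `|r t| <= r t + 2 * subopt_loss (X t) (x t) cstar.
  move=> tT; have := subopt_loss_ge _ _ _ _ cstar (dK t tT) (Xx t tT) (Xx t tT).
  have := subopt_loss_ge _ _ _ _ cstar (dK t tT) (Xx t tT) (Xxhat t tT).
  have [_ /(_ _ (Xx t tT))] := Hxhat t tT.
  rewrite subrr dot0r /r dotBl /g !dotBr => h1 h2 h3.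
  by rewrite ler_norml; apply/andP; split; lra.
have Delta0 : 0 <= Delta.
  rewrite /Delta big_nat_cond; apply: sumr_ge0 => t /andP[tT _].
  have := subopt_loss_ge _ _ _ _ cstar (dK t tT) (Xx t tT) (Xx t tT).
  by rewrite subrr dot0r.
pose b := B * n%:R * L; have b0 : 0 < b by rewrite mulr_gt0 //; lra.
have -> : Delta * B * n%:R * L = b * Delta by rewrite /b; ring.
rewrite -/b.
have sum_le M (F : nat -> R) : (forall t, (1 <= t <= T)%N -> F t <= M) ->
    \sum_(1 <= t < T.+1) F t <= M * T%:R.
  move=> FM; have -> : M * T%:R = \sum_(1 <= t < T.+1) M.
    by rewrite sumr_const_nat subSS subn0 mulr_natr.
  by apply: ler_sum_nat => t; apply: FM.
have [nT|Tn] := leqP n T; last first.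
  have RtB : Rt <= B * T%:R.
    apply: sum_le => t tT; apply: le_trans (ler_norm _) _; apply: gB => //.
    exact: Tchat.
  have Bb : B * T%:R <= b.
    rewrite /b -mulrA ler_pM2l //.
    apply: le_trans (_ : n%:R <= _); first by rewrite ler_nat ltnW.
    by rewrite ler_peMr // ltW.
  by have := sqrtr_ge0 (b * Delta); lra.
pose V := \sum_(1 <= t < T.+1) r t ^+ 2.
have V0 : 0 <= V by apply: sumr_ge0 => t _; apply: sqr_ge0.
have r2_le t M : (1 <= t <= T)%N -> `|r t| <= M -> r t ^+ 2 <= B * M.
  move=> tT rM; rewrite -real_normK ?num_real // expr2.
  by apply: ler_pM => //; apply: gB => //; apply: Tchat.
apply: (self_bounding_le b _ (Num.sqrt (V * (n%:R * L))) Rt Delta) => //.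
- exact: ltW.
- by rewrite sqr_sqrtr // mulr_ge0 // ltW.
- rewrite sqr_sqrtr; last by rewrite !mulr_ge0 //; lra.
  have -> : b * (Rt + 2 * Delta) = (B * (Rt + 2 * Delta)) * (n%:R * L).
    by rewrite /b; ring.
  rewrite ler_wpM2r //; first by rewrite mulr_ge0 //; lra.
  rewrite /Rt /Delta mulr_sumr -big_split mulr_sumr.
  by apply: ler_sum_nat => t tT; apply: r2_le => //; apply: Delta_ge.
apply: (mg_tuning B V L Rt n T (mg_N R T)) => //.
- apply: sum_le => t tT; rewrite expr2.
  by apply: r2_le => //; apply: gB => //; apply: Tchat.
- have -> : B ^+ 2 * n%:R * expR L = B * (D * K) * T%:R.
    by rewrite eL; field; rewrite !gt_eqF.
  by apply: sum_le => t tT; apply: r2_le => //; apply: rDK.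
- exact: mg_N_ge.
move=> i iN.
have [p1 A0 Tw1] := Hinit i iN.
have := mg_expert_regret Theta B D K T i cstar chat g (w i) (A i).
rewrite n0 nT => /(_ isT B0 D0 K0 ez cvx Tcs).
move=> /(_ (diam_le_sqr Theta D _ _ (ltW D0) dD Tw1 Tcs) gK) reg.
have {reg} := reg (fun t tT => gB t _ _ tT (Tchat t tT) (Tw i t iN tT)) A0
  (fun t => HA i t iN) (fun t => Hw i t iN).
have -> : \sum_(1 <= t < T.+1) surr_loss (mg_eta B i) (chat t) (g t) cstar
    = - mg_eta B i * Rt + mg_eta B i ^+ 2 * V.
  by rewrite /Rt /V !mulr_sumr -big_split.
have pot := weights_potential _ _ p f Hp p1_gt0 i T0 iN Z_le1.
have : ln (p i 1%N) - \sum_(1 <= t < T.+1) f i t <= 0.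
  rewrite -(expRK (- \sum_(1 <= t < T.+1) f i t)) -lnM ?posrE ?expR_gt0 ?p1_gt0 //.
  exact: ln_le0.
by have := @mg_prior_ln_le R T i; rewrite -p1 /f -/L; lra.
Qed.
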